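(* Let $\{f_n\}_{n\ge1}$ be a sequence of Boolean functions $f_n:\{0,1\}^{m_n}\to\{0,1\}$ and $\{p_n\}$ be a sequence in $[0,1]$. If $\{f_n\}_{n\ge1}$ is tame with respect to $\{p_n\}$, then it is noise stable with respect to $\{p_n\}$.
   Context: For each $n$, $X^{(n)}(t)=(X^{(n)}_1(t),\dots,X^{(n)}_{m_n}(t))$, $t\ge0$, where the coordinates are independent stationary continuous-time Markov chains on $\{0,1\}$ jumping from $0$ to $1$ at rate $p_n$ and from $1$ to $0$ at rate $1-p_n$ (so each is $1$ with probability $p_n$ at any fixed time). $C_n$ is the number of times $f_n(X^{(n)}(t))$ changes state during $[0,1]$. The sequence is tame with respect to $\{p_n\}$ if $\{C_n\}_{n\ge1}$ is tight. Noise stability: let $\omega_n\in\{0,1\}^{m_n}$ have i.i.d. coordinates equal to $1$ with probability $p_n$ and $0$ with probability $1-p_n$, and let $\omega_n^{\epsilon}$ be obtained from $\omega_n$ by independently for each bit, with probability $\epsilon$, replacing it by a fresh bit equal to $1$ with probability $p_n$ and $0$ with probability $1-p_n$, independently of everything else. The sequence is noise stable with respect to $\{p_n\}$ if for every $\delta>0$ there is $\epsilon>0$ with $\sup_n\mathbb{P}(f_n(\omega_n)\ne f_n(\omega_n^{\epsilon}))\le\delta$. *)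

(* Defs.v *)
From HB Require Import structures.
From mathcomp Require Import all_boot all_order all_algebra.
From mathcomp Require Import all_classical all_reals all_analysis.
Set Implicit Arguments.
Unset Strict Implicit.
Unset Printing Implicit Defensive.
Import Order.TTheory GRing.Theory Num.Theory.
Import numFieldNormedType.Exports.
Local Open Scope classical_set_scope.
Local Open Scope ring_scope.

Definition expmx (R : realType) (k : nat) (A : 'M[R]_k.+1) : 'M[R]_k.+1 :=
  limn (series (fun j : nat => (j`!%:R)^-1 *: A ^+ j)).

(* State 0 is [false], state 1 is [true]. *)
Definition state_index (b : bool) : 'I_2 := if b then ord_max else ord0.

Definition jump_rate (R : realType) (p : R) (b : bool) : R :=
  if b then 1 - p else p.

(* The Q-matrix: off-diagonal entries are the jump rates, rows sum to 0. *)
Definition generator (R : realType) (p : R) : 'M[R]_2 :=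
  \matrix_(i, j) (if i == j then - jump_rate p (i == ord_max)
                  else jump_rate p (i == ord_max)).

Definition transition (R : realType) (p t : R) (x y : bool) : R :=
  expmx (t *: generator p) (state_index x) (state_index y).

Definition cylinder (R : realType) (T : Type) (Y : R -> T -> bool) (k : nat)
    (s : 'I_k -> R) (x : 'I_k -> bool) : set T :=
  [set w | forall j, Y (s j) w = x j].

(* Times range over [0, +oo[; the values of [Y] at negative times play no role.
   Paths are right-continuous with left limits in the discrete space {0,1}. *)
Record stationary_chain (R : realType) (d : measure_display)
    (T : measurableType d) (P : probability T R) (p : R)
    (Y : R -> T -> bool) : Prop := StationaryChain {
  chain_measurable : forall t, 0 <= t -> measurable_fun setT (Y t) ;
  chain_right_continuous : forall w t, 0 <= t ->
    \forall s \near t^'+, Y s w = Y t w ;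
  chain_left_limits : forall w t, 0 < t ->
    exists b : bool, \forall s \near t^'-, Y s w = b ;
  chain_markov : forall (k : nat) (s : 'I_k.+1 -> R) (x : 'I_k.+1 -> bool)
      (t : R) (y : bool),
    (forall j, 0 <= s j) ->
    (forall i j : 'I_k.+1, (i <= j)%N -> s i <= s j) ->
    s ord_max <= t ->
    P (cylinder Y s x `&` Y t @^-1` [set y]) =
      (P (cylinder Y s x) * (transition p (t - s ord_max) (x ord_max) y)%:E)%E ;
  chain_stationary : forall (k : nat) (s : 'I_k -> R) (x : 'I_k -> bool) (h : R),
    (forall j, 0 <= s j) -> 0 <= h ->
    P (cylinder Y (fun j => s j + h) x) = P (cylinder Y s x) }.

Definition process_sigma (R : realType) (T : Type) (Y : R -> T -> bool) :
    set (set T) :=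
  <<s [set A | exists t b, 0 <= t /\ A = Y t @^-1` [set b]] >>.

(* Some of the [A i] may be [setT], so this includes all subfamilies. *)
Definition independent_processes (R : realType) (d : measure_display)
    (T : measurableType d) (P : probability T R) (m : nat)
    (X : 'I_m -> R -> T -> bool) : Prop :=
  forall A : 'I_m -> set T, (forall i, process_sigma (X i) (A i)) ->
    P (\bigcap_i A i) = (\prod_(i < m) P (A i))%E.

Definition bit_dynamics (R : realType) (d : measure_display)
    (T : measurableType d) (P : probability T R) (m : nat) (p : R)
    (X : 'I_m -> R -> T -> bool) : Prop :=
  (forall i, stationary_chain P p (X i)) /\ independent_processes P X.

Definition configuration (R : realType) (T : Type) (m : nat)
    (X : 'I_m -> R -> T -> bool) (t : R) (w : T) : {ffun 'I_m -> bool} :=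
  [ffun i => X i t w].

Definition change_times (R : realType) (g : R -> bool) : set R :=
  [set t | 0 < t <= 1 /\ ~ (\forall s \near t^'-, g s = g t)].

Definition num_changes (R : realType) (T : Type) (m : nat)
    (f : {ffun 'I_m -> bool} -> bool) (X : 'I_m -> R -> T -> bool) (w : T) :
    \bar R :=
  counting (change_times (fun t => f (configuration X t w))).

Definition tight (R : realType) (d : nat -> measure_display)
    (T : forall n, measurableType (d n)) (P : forall n, probability (T n) R)
    (C : forall n, T n -> \bar R) : Prop :=
  forall eta : R, 0 < eta -> exists K : R, forall n,
    (P n [set w | K%:E < `|C n w|] <= eta%:E)%E.

Definition tame (R : realType) (m : nat -> nat)
    (f : forall n, {ffun 'I_(m n) -> bool} -> bool) (d : nat -> measure_display)
    (T : forall n, measurableType (d n)) (P : forall n, probability (T n) R)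
    (X : forall n, 'I_(m n) -> R -> T n -> bool) : Prop :=
  tight P (fun n => num_changes (f n) (X n)).

Definition bits_weight (R : realType) (m : nat) (p : R)
    (x : {ffun 'I_m -> bool}) : R :=
  \prod_(i < m) (if x i then p else 1 - p).

(* [r] marks the refreshed bits of [x], [y] holds the fresh bits. *)
Definition rerandomize (m : nat) (x r y : {ffun 'I_m -> bool}) :
    {ffun 'I_m -> bool} :=
  [ffun i => if r i then y i else x i].

(* P(f(omega) != f(omega^eps)); [x], [r] and [y] are independent. *)
Definition disagreement (R : realType) (m : nat)
    (f : {ffun 'I_m -> bool} -> bool) (p eps : R) : R :=
  \sum_(x : {ffun 'I_m -> bool}) \sum_(r : {ffun 'I_m -> bool})
    \sum_(y : {ffun 'I_m -> bool} | f x != f (rerandomize x r y))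
      bits_weight p x * bits_weight eps r * bits_weight p y.

Definition noise_stable (R : realType) (m : nat -> nat)
    (f : forall n, {ffun 'I_(m n) -> bool} -> bool) (p : nat -> R) : Prop :=
  forall delta : R, 0 < delta -> exists eps : R, 0 < eps <= 1 /\
    forall n, disagreement (f n) (p n) eps <= delta.

(* Main.v *)
Require Import Defs.
From mathcomp Require Import all_boot all_order all_algebra.
From mathcomp Require Import all_classical all_reals all_analysis.
From mathcomp Require Import measurable_realfun.
From mathcomp Require Import ring lra.
Set Implicit Arguments.
Unset Strict Implicit.
Unset Printing Implicit Defensive.
Import Order.TTheory GRing.Theory Num.Theory.
Import numFieldNormedType.Exports.
Local Open Scope classical_set_scope.
Local Open Scope ring_scope.
(** Cut [0,1] into N intervals of length 1/N.  Along any path the number of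
    intervals whose endpoints receive different values of f is at most C_n, and
    by stationarity its expectation is N a, where
    a = P(f(X(0)) <> f(X(1/N))).  Splitting according to whether C_n > K yields
    N a <= K + N P(C_n > K), so tightness makes a uniformly small once N is
    large.  The generator satisfies Q^2 = -Q, hence
    exp(tQ) = 1 + (1 - exp(-t)) Q: after time t each bit has been refreshed with
    probability 1 - exp(-t), so a is the noise disagreement at
    eps = 1 - exp(-1/N). *)

(** * Change times of a path and flips along a mesh *)

Lemma change_time_between (R : realType) (g : R -> bool) (a b : R) :
  (forall t, a <= t -> \forall s \near t^'+, g s = g t) -> a < b -> g a != g b ->
  exists2 t, a < t <= b & ~ (\forall s \near t^'-, g s = g t).
Proof.
move=> gr ab gab.
(* The witness is the supremum of the times up to which g has kept the value g a. *)
pose E := [set t : R | a <= t <= b /\ forall s, a <= s <= t -> g s = g a].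
have Ea : E a.
  split=> [|s /andP[as1 sa]]; first by rewrite lexx ltW.
  by congr g; apply/le_anti; rewrite as1 sa.
have ubE : has_ubound E by exists b => t [/andP[]].
set tau := sup E.
have atau : a <= tau by exact: ub_le_sup.
have taub : tau <= b by apply: ge_sup => [|t [/andP[]]]; first by exists a.
have gE s : a <= s -> s < tau -> g s = g a.
  move=> as1 st.
  have [|e Ee se] := @sup_adherent _ E (tau - s) _ (conj (ex_intro _ a Ea) ubE).
    by rewrite subr_gt0.
  have {}se : s < e by rewrite (le_lt_trans _ se)// /tau; lra.
  by apply: Ee.2; rewrite as1 ltW.
(* Otherwise right continuity would keep the value [g a] up to some [u > tau], contradicting the
   choice of [tau]. *)
have gtau : g tau != g a.
  apply/negP => /eqP gta.
  have {}gE s : a <= s <= tau -> g s = g a.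
    by move=> /andP[as1]; rewrite le_eqVlt => /predU1P[->//|]; exact: gE.
  have tb : tau < b.
    by rewrite lt_neqAle taub andbT; apply: contraNneq gab => <-; rewrite gta.
  have /= [e e0 He] := gr _ atau.
  pose u := Num.min b (tau + e / 2).
  have tu : tau < u by rewrite lt_min tb ltrDl divr_gt0.
  have : E u.
    split=> [|s /andP[as1 su]].
      by rewrite (le_trans atau (ltW tu)) ge_min lexx.
    have [st|ts] := leP s tau; first by rewrite gE// as1.
    rewrite He//= distrC gtr0_norm ?subr_gt0//.
    have : s <= tau + e / 2 by apply: (le_trans su); rewrite /u ge_min lexx orbT.
    by move: e0 => /=; lra.
  by move/(ub_le_sup ubE); rewrite leNgt tu.
have atau' : a < tau.
  by rewrite lt_neqAle atau andbT; apply: contraNneq gtau => <-.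
exists tau; first by rewrite atau'.
(* Left continuity at [tau] would give a point of []a, tau[] with value [g tau], where [g] still
   equals [g a]. *)
move=> H; have [s [gs sa st]] : exists s, [/\ g s = g tau, a < s & s < tau].
  near tau^'- => s; exists s; split; near: s => //.
    exact: nbhs_left_gt.
  exact: nbhs_left_lt.
by move: gtau; rewrite -gs gE ?ltW// eqxx.
Unshelve. all: by end_near. Qed.

Definition mesh_changes (R : realType) (g : R -> bool) (N : nat) : {set 'I_N} :=
  [set i : 'I_N | g (i%:R / N%:R) != g (i.+1%:R / N%:R)]%SET.

(** Every flipped mesh interval contains a change time, and the intervals, open on the left and
    closed on the right, are disjoint. *)
Lemma mesh_changes_le_counting (R : realType) (g : R -> bool) (N : nat) :
  (forall t, 0 <= t -> \forall s \near t^'+, g s = g t) ->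
  ((#|mesh_changes g N|%:R : R)%:E <= counting (change_times g))%E.
Proof.
move=> gr; rewrite /counting; case: asboolP => [fin|_]; last exact: leey.
have /choice[h hP] : forall i : 'I_N, exists t : R, i \in mesh_changes g N ->
    i%:R / N%:R < t <= i.+1%:R / N%:R /\ change_times g t.
  move=> i; have [|] := boolP (i \in mesh_changes g N); last by exists 0.
  rewrite inE => gi; have N0 : 0 < (N%:R : R) by rewrite ltr0n (leq_trans _ (ltn_ord i)).
  have [||t ti tP] := change_time_between _ _ gi.
  - by move=> t it; apply: gr; rewrite (le_trans _ it)// divr_ge0.
  - by rewrite ltr_pM2r ?invr_gt0// ltr_nat.
  exists t => _; split=> //; split=> //; case/andP: ti => it ti.
  rewrite (le_lt_trans _ it) ?divr_ge0//= (le_trans ti)//.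
  by rewrite ler_pdivrMr// mul1r ler_nat.
have N0 (i : 'I_N) : 0 < (N%:R : R) by rewrite ltr0n (leq_trans _ (ltn_ord i)).
have hlt (i j : 'I_N) : i \in mesh_changes g N -> j \in mesh_changes g N ->
    (i < j)%N -> h i < h j.
  move=> /hP[/andP[_ hi] _] /hP[/andP[hj _] _] ij.
  rewrite (le_lt_trans hi)// (le_lt_trans _ hj)//.
  by rewrite ler_pM2r ?invr_gt0 ?(N0 i)// ler_nat.
rewrite lee_fin ler_nat cardE -(size_map h); apply: uniq_leq_size.
  rewrite map_inj_in_uniq ?enum_uniq// => i j; rewrite !mem_enum => iM jM hij.
  have [ij|ij|//] := ltngtP (nat_of_ord i) j; last exact/val_inj.
  - by have := hlt _ _ iM jM ij; rewrite hij ltxx.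
  - by have := hlt _ _ jM iM ij; rewrite hij ltxx.
move=> _ /mapP[i + ->]; rewrite mem_enum => /hP[_ ci].
by rewrite in_fset_set// inE.
Qed.

(** Extracts finitely many points, so that finite and infinite counts can afterwards be treated
    alike. *)
Lemma lt_counting_subseq (R : realType) (T : choiceType) (A : set T) (K : R) :
  (K%:E < counting A)%E ->
  exists s : seq T, [/\ uniq s, {in s, forall t, A t} & K < (size s)%:R].
Proof.
rewrite /counting; case: asboolP => [fin|inf].
  rewrite lte_fin => KA; exists (finmap.enum_fset (fset_set A)).
  split=> //.
  by move=> t; rewrite in_fset_set// inE.
move=> _; pose n := (Num.truncn K).+1.
suff [s [us As ss]] : exists s : seq T, [/\ uniq s, {in s, forall t, A t} & size s = n].
  by exists s; split=> //; rewrite ss truncnS_gt.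
elim: n => [|n [s [us As ss]]]; first by exists [::].
have [t [At ts]] : exists t, A t /\ t \notin s.
  apply/not_existsP => H; apply: inf; apply: (sub_finite_set _ (finite_seq s)).
  move=> t At /=; have := H t; case: (boolP (t \in s)) => // ts.
  by case; split.
exists (t :: s); split.
- by rewrite /= ts us.
- by move=> u; rewrite inE => /predU1P[->//|/As].
- by rewrite /= ss.
Qed.

(** The index is [k - 1] for the least natural [k] with [t * N <= k]; minimality gives the strict
    lower bound. *)
Lemma mesh_index (R : realType) (N : nat) (t : R) : (0 < N)%N -> 0 < t <= 1 ->
  exists i : 'I_N, i%:R / N%:R < t <= i.+1%:R / N%:R.
Proof.
move=> N0 /andP[t0 t1]; have NR : 0 < (N%:R : R) by rewrite ltr0n.
have ex : exists k : nat, t * N%:R <= k%:R by exists N; rewrite ler_piMl.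
case: (ex_minnP ex) => k tk kmin.
have k0 : (0 < k)%N.
  by rewrite -(ltr0n R) (lt_le_trans _ tk)// mulr_gt0.
have kN : (k.-1 < N)%N.
  by rewrite prednK// kmin// ler_piMl.
exists (Ordinal kN); rewrite /= prednK// ltr_pdivrMr// ler_pdivlMr// tk andbT.
rewrite ltNge; apply/negP => /kmin.
by rewrite -{1}(prednK k0) ltnn.
Qed.

(** The left limit exists and differs from [g t], so all close enough sample times straddling [t]
    detect the change. The case [v = t] is included because a change time may be a mesh point. *)
Lemma change_time_window (R : realType) (g : R -> bool) (t : R) :
  (\forall s \near t^'+, g s = g t) -> (exists b, \forall s \near t^'-, g s = b) ->
  ~ (\forall s \near t^'-, g s = g t) ->
  exists2 e : R, 0 < e & forall u v, t - e < u < t -> t <= v < t + e -> g u != g v.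
Proof.
move=> [d /= d0 gd] [b gb] ngt.
have bt : b != g t by apply/eqP => bt; apply: ngt; rewrite -bt.
have [c /= c0 gc] := gb.
exists (Num.min c d); first by rewrite lt_min c0.
move=> u v /andP[]; rewrite ltrBlDr -ltrBlDl lt_min => /andP[uc _] ut.
move=> /andP[tv]; rewrite -ltrBlDl lt_min => /andP[_ vd].
rewrite gc//= ?gtr0_norm ?subr_gt0//.
move: tv; rewrite le_eqVlt => /predU1P[<-//|tv].
by rewrite gd//= distrC gtr0_norm ?subr_gt0.
Qed.

(** Converse to [mesh_changes_le_counting]: for finitely many change times, a mesh finer than their
    windows and their mutual distances puts them into distinct intervals, all of which flip. *)
Lemma mesh_changes_attain (R : realType) (g : R -> bool) (K : R) :
  (forall t, 0 <= t -> \forall s \near t^'+, g s = g t) ->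
  (forall t, 0 < t -> exists b, \forall s \near t^'-, g s = b) ->
  (K%:E < counting (change_times g))%E ->
  exists N, K < #|mesh_changes g N.+1|%:R.
Proof.
move=> gr gl /lt_counting_subseq[s [us sc Ks]].
have [N [NP ND]] : exists N : nat,
    (forall i : 'I_(size s), forall u v, let t := nth 0 s i in
      t - N.+1%:R^-1 <= u < t -> t <= v < t + N.+1%:R^-1 -> g u != g v) /\
    (forall i j : 'I_(size s), i != j ->
      N.+1%:R^-1 < `|nth 0 s i - nth 0 s j|).
  near \oo => N; exists N; split; near: N.
    apply: filter_forall => i.
    have [/andP[t0 t1] ngt] := sc _ (mem_nth 0 (ltn_ord i)).
    have [e e0 He] := change_time_window (gr _ (ltW t0)) (gl _ t0) ngt.
    have := near_infty_natSinv_lt (PosNum e0) => /=; apply: filterS => N Ne.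
    move=> u v /= /andP[tu ut] /andP[tv vt]; apply: He.
      by rewrite ut andbT (lt_le_trans _ tu)// ltrD2l ltrN2.
    by rewrite tv (lt_trans vt)// ltrD2l.
  apply: filter_forall => i; apply: filter_forall => j.
  have [->|ij] := eqVneq i j; first exact: nearW.
  have e0 : 0 < `|nth 0 s i - nth 0 s j|.
    by rewrite normr_gt0 subr_eq0 nth_uniq.
  have := near_infty_natSinv_lt (PosNum e0) => /=.
  by apply: filterS => N Ne _.
exists N; apply: (lt_le_trans Ks); rewrite ler_nat.
have /choice[h hP] : forall i : 'I_(size s), exists j : 'I_N.+1,
    j%:R / N.+1%:R < nth 0 s i <= j.+1%:R / N.+1%:R.
  by move=> i; apply: mesh_index => //; case: (sc _ (mem_nth 0 (ltn_ord i))).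
have step (j : nat) : j.+1%:R / N.+1%:R = j%:R / N.+1%:R + N.+1%:R^-1 :> R.
  by rewrite -natr1 mulrDl mul1r.
(* Two points of one half-open mesh interval are closer than the mesh width, against [ND]. *)
have hinj : injective h.
  move=> i j hij; apply: contraTeq isT => /ND.
  move: (hP i) (hP j); rewrite hij step ltr_normr.
  move: ((h j)%:R / N.+1%:R : R) (N.+1%:R^-1 : R) (nth 0 s i) (nth 0 s j) => q r y z.
  by move=> /andP[a b] /andP[c e] /orP[]; lra.
have sub : [set h i | i in 'I_(size s)]%SET \subset mesh_changes g N.+1.
  apply/fintype.subsetP => _ /imsetP[i _ ->]; rewrite inE.
  move: (hP i); rewrite step => /andP[a b]; apply: (NP i) => /=.
    by rewrite a andbT lerBlDr.
  by rewrite b ltrD2r.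
by have := subset_leq_card sub; rewrite card_imset// card_ord.
Unshelve. all: by end_near. Qed.

(** * The transition matrix in closed form *)

(** The two rates add up to 1, so the generator has eigenvalues 0 and -1. *)
Lemma generator_sqr (R : realType) (p : R) :
  generator p * generator p = - generator p.
Proof.
apply/matrixP => i j; rewrite !mxE !big_ord_recl big_ord0 !mxE /jump_rate.
by case: i => -[|[|//]] ?; case: j => -[|[|//]] ? /=; ring.
Qed.

(** All positive powers of the generator are multiples of it, so the matrix series reduces to the
    scalar series of [expR (- t)]. *)
Lemma expmx_generator (R : realType) (p t : R) :
  expmx (t *: generator p) = 1 + (1 - expR (- t)) *: generator p.
Proof.
pose G := generator p.
have powG n : (t *: G) ^+ n.+1 = - (- t) ^+ n.+1 *: G.
  elim: n => [|n IHn]; first by rewrite !expr1 opprK.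
  rewrite exprS IHn -scalerAl -scalerAr generator_sqr !scalerN !scalerA -scaleNr.
  by rewrite [(- t) ^+ n.+2]exprS; congr (_ *: _); ring.
have seriesE n : series (fun j => (j`!%:R)^-1 *: (t *: G) ^+ j) n.+1 =
    1 + (1 - series (exp_coeff (- t)) n.+1) *: G.
  elim: n => [|n IHn].
    rewrite /series /= !big_nat1 /exp_coeff /= !expr0 fact0 invr1 scale1r.
    by rewrite mulr1 subrr scale0r addr0.
  rewrite seriesSr IHn [series (exp_coeff _) n.+2]seriesSr powG /exp_coeff /=.
  rewrite scalerA -addrA -scalerDl; congr (_ + _ *: _); ring.
rewrite /expmx; apply/cvg_lim => //.
(* The index is shifted because [seriesE] covers only nonempty partial sums; the empty one is 0. *)
rewrite -(cvg_shiftS (series _)) /=.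
under eq_cvg do rewrite seriesE.
apply: cvgD; first exact: cvg_cst.
apply: cvgZr_tmp; apply: cvgB; first exact: cvg_cst.
rewrite (cvg_shiftS (series _)).
exact: is_cvg_series_exp_coeff.
Qed.

(** This form exhibits the refresh mechanism: the bit is kept with weight [expR (- t)] and otherwise
    redrawn with bias [p]. *)
Lemma transitionE (R : realType) (p t : R) (x y : bool) :
  transition p t x y =
  expR (- t) * (x == y)%:R + (1 - expR (- t)) * (if y then p else 1 - p).
Proof.
rewrite /transition expmx_generator !mxE /jump_rate /state_index.
by case: x; case: y => /=; ring.
Qed.

(** * Laws of one bit at one and at two times *)

Definition bit_weight (R : realType) (p : R) (b : bool) : R :=
  if b then p else 1 - p.

Lemma bit_chain_markov (R : realType) (d : measure_display) (T : measurableType d)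
    (P : probability T R) (p : R) (Y : R -> T -> bool) (a b : R) (x y : bool) :
  stationary_chain P p Y -> 0 <= a <= b ->
  P (Y a @^-1` [set x] `&` Y b @^-1` [set y]) =
  (P (Y a @^-1` [set x]) * (transition p (b - a) x y)%:E)%E.
Proof.
move=> HY /andP[a0 ab].
have := @chain_markov _ _ _ _ _ _ HY 0 (fun=> a) (fun=> x) b y (fun=> a0)
  (fun _ _ _ => lexx _) ab.
have -> // : cylinder Y (fun _ : 'I_1 => a) (fun=> x) = Y a @^-1` [set x].
by apply/seteqP; split=> w /=; [apply; exact: ord0 | move=> H j].
Qed.

Lemma measurable_chain_event (R : realType) (d : measure_display)
    (T : measurableType d) (P : probability T R) (p : R) (Y : R -> T -> bool)
    (a : R) (x : bool) :
  stationary_chain P p Y -> 0 <= a -> measurable (Y a @^-1` [set x]).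
Proof.
move=> HY a0; rewrite -[X in measurable X]setTI.
exact: (chain_measurable HY a0).
Qed.

(** The record [stationary_chain] prescribes no initial law. Equating the probabilities [q] of state
    1 at two times forces [q = p], the invariant law. *)
Lemma bit_chain_law (R : realType) (d : measure_display) (T : measurableType d)
    (P : probability T R) (p : R) (Y : R -> T -> bool) (a : R) (x : bool) :
  stationary_chain P p Y -> 0 <= a ->
  P (Y a @^-1` [set x]) = (bit_weight p x)%:E.
Proof.
move=> HY a0.
have mY t b := @measurable_chain_event _ _ _ _ _ _ t b HY.
have YC t : Y t @^-1` [set false] = ~` (Y t @^-1` [set true]).
  by apply/seteqP; split=> w /=; case: (Y t w).
suff PT : P (Y a @^-1` [set true]) = p%:E.
  case: x => //=; rewrite YC probability_setC ?PT//; exact: mY.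
pose q := fine (P (Y a @^-1` [set true])).
have qE : P (Y a @^-1` [set true]) = q%:E.
  by rewrite fineK// fin_num_measure//; exact: mY.
have qF : P (Y a @^-1` [set false]) = (1 - q)%:E.
  by rewrite YC probability_setC ?qE//; exact: mY.
(* The shift 1 is arbitrary: any positive [h] makes the factor [1 - expR (- h)] nonzero. *)
have a1 : 0 <= a <= a + 1 by rewrite a0 lerDl ler01.
have a10 : 0 <= a + 1 by apply: addr_ge0.
have shift1 : P (Y (a + 1) @^-1` [set true]) = P (Y a @^-1` [set true]).
  have := @chain_stationary _ _ _ _ _ _ HY 1 (fun=> a) (fun=> true) 1 (fun=> a0) ler01.
  have cylE t : cylinder Y (fun _ : 'I_1 => t) (fun=> true) = Y t @^-1` [set true].
    by apply/seteqP; split=> w /=; [apply; exact: ord0 | move=> H j].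
  by rewrite !cylE.
pose A b := Y a @^-1` [set b] `&` Y (a + 1) @^-1` [set true].
have split1 : P (Y (a + 1) @^-1` [set true]) = (P (A true) + P (A false))%E.
  rewrite -measureU; first last.
  - by rewrite /A YC setIACA setICr set0I.
  - by apply: measurableI; exact: mY.
  - by apply: measurableI; exact: mY.
  by rewrite /A -setIUl YC setUv setTI.
move: split1; rewrite shift1.
rewrite /A !(bit_chain_markov _ _ HY a1) qE qF !transitionE /= -!EFinM -EFinD => -[].
rewrite addrAC subrr add0r => H; congr (_%:E).
have e1 : expR (- 1) < 1 :> R by rewrite expR_lt1 ltrN10.
have : (1 - expR (- 1)) * (q - p) = 0 by lra.
by move/eqP; rewrite mulf_eq0 !subr_eq0 (gt_eqF e1) => /eqP.
Qed.

Lemma bit_chain_joint_law (R : realType) (d : measure_display)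
    (T : measurableType d) (P : probability T R) (p : R) (Y : R -> T -> bool)
    (a b : R) (x y : bool) :
  stationary_chain P p Y -> 0 <= a <= b ->
  P (Y a @^-1` [set x] `&` Y b @^-1` [set y]) =
  (bit_weight p x * transition p (b - a) x y)%:E.
Proof.
move=> HY ab; rewrite (bit_chain_markov _ _ HY ab) (bit_chain_law _ HY).
  by rewrite EFinM.
by case/andP: ab.
Qed.

(** * Joint law of the configuration at two times *)

Lemma configuration_preimage (R : realType) (T : Type) (m : nat)
    (X : 'I_m -> R -> T -> bool) (a : R) (x : {ffun 'I_m -> bool}) :
  configuration X a @^-1` [set x] = \bigcap_i (X i a @^-1` [set x i]).
Proof.
apply/seteqP; split=> w /=; first by move=> <- i _ /=; rewrite ffunE.
by move=> H; apply/ffunP => i; rewrite ffunE; exact: H.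
Qed.

Lemma configuration_joint_law (R : realType) (d : measure_display)
    (T : measurableType d) (P : probability T R) (m : nat) (p : R)
    (X : 'I_m -> R -> T -> bool) (a b : R) (x z : {ffun 'I_m -> bool}) :
  bit_dynamics P p X -> 0 <= a <= b ->
  P (configuration X a @^-1` [set x] `&` configuration X b @^-1` [set z]) =
  (\prod_(i < m) (bit_weight p (x i) * transition p (b - a) (x i) (z i)))%:E.
Proof.
move=> [chX indX] ab; rewrite !configuration_preimage -bigcapI indX.
  rewrite -prodEFin; apply: eq_bigr => i _.
  exact: bit_chain_joint_law.
(* Independence was applied to one two-time event per bit; each must lie in the sigma-algebra
   generated by that bit's process. *)
case/andP: ab => a0 ab i.
pose G := [set A | exists t c, 0 <= t /\ A = X i t @^-1` [set c]].
apply: (@measurableI _ (g_sigma_algebraType G)); apply: sub_gen_smallest.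
  by exists a, (x i).
by exists b, (z i); rewrite (le_trans a0).
Qed.

Lemma measurable_configuration (R : realType) (d : measure_display)
    (T : measurableType d) (P : probability T R) (m : nat) (p : R)
    (X : 'I_m -> R -> T -> bool) (a : R) (x : {ffun 'I_m -> bool}) :
  bit_dynamics P p X -> 0 <= a ->
  measurable (configuration X a @^-1` [set x]).
Proof.
move=> [chX _] a0; rewrite configuration_preimage.
apply: fin_bigcap_measurable => // i _; exact: measurable_chain_event.
Qed.

(** * Flip events and the noise disagreement *)

Definition flip_event (R : realType) (T : Type) (m : nat)
    (f : {ffun 'I_m -> bool} -> bool) (X : 'I_m -> R -> T -> bool) (a b : R) :
    set T :=
  [set w | f (configuration X a w) != f (configuration X b w)].

(** A finite disjoint decomposition, which yields both measurability and the probability as a finite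
    sum. *)
Lemma flip_event_bigcup (R : realType) (T : Type) (m : nat)
    (f : {ffun 'I_m -> bool} -> bool) (X : 'I_m -> R -> T -> bool) (a b : R) :
  flip_event f X a b =
  \bigcup_(u in [set` [pred u : {ffun 'I_m -> bool} * {ffun 'I_m -> bool} |
      f u.1 != f u.2]])
    (configuration X a @^-1` [set u.1] `&` configuration X b @^-1` [set u.2]).
Proof.
apply/seteqP; split=> w /=.
  by exists (configuration X a w, configuration X b w).
by move=> [[x z] /= xz [xE zE]]; rewrite /flip_event /= xE zE.
Qed.

Lemma measurable_flip_event (R : realType) (d : measure_display)
    (T : measurableType d) (P : probability T R) (m : nat) (p : R)
    (f : {ffun 'I_m -> bool} -> bool) (X : 'I_m -> R -> T -> bool) (a b : R) :
  bit_dynamics P p X -> 0 <= a -> 0 <= b -> measurable (flip_event f X a b).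
Proof.
move=> HX a0 b0; rewrite flip_event_bigcup; apply: fin_bigcup_measurable => //.
by move=> u _; apply: measurableI; exact: (measurable_configuration _ HX).
Qed.

(** For fixed [x] and outcome [z], summing over the marks [r] and the fresh bits [y] factors over
    coordinates, and each factor has the shape of [transitionE]. *)
Lemma disagreementE (R : realType) (m : nat)
    (f : {ffun 'I_m -> bool} -> bool) (p eps : R) :
  disagreement f p eps =
  \sum_(x : {ffun 'I_m -> bool}) \sum_(z : {ffun 'I_m -> bool} | f x != f z)
    \prod_(i < m) (bit_weight p (x i) *
      ((1 - eps) * (x i == z i)%:R + eps * bit_weight p (z i))).
Proof.
apply: eq_bigr => x _.
pose w (r y : {ffun 'I_m -> bool}) := bits_weight p x * bits_weight eps r * bits_weight p y.
(* Group the pairs [(r, y)] by the configuration [z] that they produce. *)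
transitivity (\sum_(z | f x != f z) \sum_r \sum_(y | rerandomize x r y == z) w r y).
  rewrite exchange_big /=; apply: eq_bigr => r _.
  rewrite (partition_big (rerandomize x r) [pred z | f x != f z])//=.
  apply: eq_bigr => z xz; apply: eq_bigl => y.
  by case: (rerandomize x r y =P z) => [->|]; rewrite ?xz ?andbF.
apply: eq_bigr => z _; rewrite big_split /=.
(* The constraint [rerandomize x r y = z] becomes a product of one indicator per bit, so that sums
   and products can be exchanged. *)
transitivity (bits_weight p x *
    \sum_(r : {ffun 'I_m -> bool}) \sum_(y : {ffun 'I_m -> bool}) \prod_(i < m)
    (if (if r i then y i else x i) == z i
     then bit_weight eps (r i) * bit_weight p (y i) else 0)).
  rewrite big_distrr; apply: eq_bigr => r _ /=.
  rewrite big_distrr big_mkcond; apply: eq_bigr => y _ /=.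
  case: eqP => [<-|neq].
    rewrite /w -mulrA -big_split; congr (_ * _); apply: eq_bigr => i _ /=.
    by rewrite ffunE eqxx.
  have [i] : exists i, rerandomize x r y i != z i.
    apply/existsP; apply: contra_notT neq => /existsPn H; apply/ffunP => i.
    exact/eqP/negPn/H.
  by rewrite ffunE => /negPf zi; rewrite (bigD1 i)//= zi mul0r mulr0.
congr (_ * _).
pose F i (b c : bool) := if (if b then c else x i) == z i
  then bit_weight eps b * bit_weight p c else 0.
transitivity (\sum_(r : {ffun 'I_m -> bool}) \prod_(i < m) \sum_c F i (r i) c).
  by apply: eq_bigr => r _; rewrite (bigA_distr_bigA (fun i => F i (r i))).
rewrite -(bigA_distr_bigA (fun i b => \sum_c F i b c)) /F.
apply: eq_bigr => i _; rewrite !big_bool /bit_weight.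
by case: (x i); case: (z i) => /=; ring.
Qed.

(** The product formulas for the dynamics and for the noise agree term by term when
    [1 - eps = expR (- (b - a))]. *)
Lemma flip_probability (R : realType) (d : measure_display)
    (T : measurableType d) (P : probability T R) (m : nat) (p : R)
    (f : {ffun 'I_m -> bool} -> bool) (X : 'I_m -> R -> T -> bool) (a b : R) :
  bit_dynamics P p X -> 0 <= a <= b ->
  P (flip_event f X a b) = (disagreement f p (1 - expR (- (b - a))))%:E.
Proof.
move=> HX ab; have /andP[a0 leab] := ab.
rewrite flip_event_bigcup measure_fin_bigcup//; last 2 first.
- move=> [x z] [x' z'] _ _ [w /= [[<- <-] [<- <-]]] //.
- move=> u _; apply: measurableI; apply: (measurable_configuration _ HX) => //.
  exact: le_trans leab.
rewrite disagreementE -sumEFin.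
under [RHS]eq_bigr do rewrite -sumEFin.
rewrite pair_big_dep /=; set D := [set` _].
have -> : D = [set` [seq u <- index_enum _ | u \in D]].
  by apply/seteqP; split=> u /=; rewrite mem_filter mem_index_enum andbT inE.
rewrite -fsbig_seq ?filter_uniq ?index_enum_uniq// big_filter.
apply: eq_big => [u|u _]; first by rewrite mem_setE.
rewrite (configuration_joint_law _ _ HX ab); congr (_%:E).
apply: eq_bigr => i _; rewrite transitionE /bit_weight.
by rewrite (opprB 1) addrCA subrr addr0.
Qed.

(** * Expected number of flips *)

(** Integrate the pointwise bound of the sum of indicators by [K + N * \1_E]: on [E] the sum is at
    most its number [N] of terms. *)
Lemma sum_measure_le (R : realType) (d : measure_display) (T : measurableType d)
    (P : probability T R) (N : nat) (B : 'I_N -> set T) (E : set T) (K : R) :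
  (forall i, measurable (B i)) -> measurable E -> 0 <= K ->
  (forall w, ~ E w -> \sum_(i < N) \1_(B i) w <= K) ->
  (\sum_(i < N) P (B i) <= K%:E + N%:R%:E * P E)%E.
Proof.
move=> mB mE K0 HK.
have mI (A : set T) : measurable A -> measurable_fun setT (EFin \o (\1_A : T -> R)).
  by move=> mA; apply/measurable_EFinP; exact: measurable_indic.
have I0 (A : set T) w : (0 <= (\1_A w : R)%:E)%E by rewrite lee_fin indicE.
have <- : (\int[P]_w \sum_(i < N) (\1_(B i) w)%:E = \sum_(i < N) P (B i))%E.
  rewrite ge0_integral_sum//; last by move=> i; exact: mI.
  by apply: eq_bigr => i _; rewrite integral_indic// setIT.
have <- : (\int[P]_w (K%:E + N%:R%:E * (\1_E w)%:E) = K%:E + N%:R%:E * P E)%E.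
  rewrite ge0_integralD//; last by apply: measurable_funeM; exact: mI.
  rewrite (integral_cst _ _ K%:E)//= probability_setT mule1.
  rewrite ge0_integralZl ?lee_fin//; last exact: mI.
  by rewrite integral_indic// setIT.
apply: ge0_le_integral => //.
- by move=> w _; apply: sume_ge0.
- by apply: emeasurable_sum => i; exact: mI.
- by apply: emeasurable_funD => //; apply: measurable_funeM; exact: mI.
move=> w _; rewrite sumEFin -EFinM -EFinD lee_fin.
have [Ew|Ew] := pselect (E w).
  rewrite [\1_E w]indicE mem_set// mulr1 ler_wpDl//.
  have -> : N%:R = \sum_(i < N) 1 :> R by rewrite sumr_const card_ord.
  by apply: ler_sum => i _; rewrite indicE; case: (_ \in _).
by rewrite (le_trans (HK _ Ew))// lerDl mulr_ge0.
Qed.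

Definition mesh_flip (R : realType) (T : Type) (m : nat)
    (f : {ffun 'I_m -> bool} -> bool) (X : 'I_m -> R -> T -> bool) (N : nat)
    (i : 'I_N) : set T :=
  flip_event f X (i%:R / N%:R) (i.+1%:R / N%:R).

Lemma card_mesh_changes (R : realType) (T : Type) (m : nat)
    (f : {ffun 'I_m -> bool} -> bool) (X : 'I_m -> R -> T -> bool) (N : nat)
    (w : T) :
  #|mesh_changes (fun t => f (configuration X t w)) N|%:R =
  \sum_(i < N) \1_(mesh_flip f X i) w :> R.
Proof.
rewrite -sum1_card natr_sum big_mkcond; apply: eq_bigr => i _.
rewrite inE indicE /mesh_flip /flip_event; case: ifPn => H.
  by rewrite mem_set.
by rewrite memNset//=; apply/negP.
Qed.

Lemma num_changes_ge0 (R : realType) (T : Type) (m : nat)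
    (f : {ffun 'I_m -> bool} -> bool) (X : 'I_m -> R -> T -> bool) (w : T) :
  (0 <= num_changes f X w)%E.
Proof.
by rewrite /num_changes /counting; case: asboolP => _; rewrite ?lee_fin ?leey.
Qed.

(** * The tail event of the number of changes *)

Section dynamics_paths.
Context (R : realType) (d : measure_display) (T : measurableType d)
  (P : probability T R) (m : nat) (p : R) (f : {ffun 'I_m -> bool} -> bool)
  (X : 'I_m -> R -> T -> bool) (HX : bit_dynamics P p X).

Lemma value_right_continuous w t : 0 <= t ->
  \forall s \near t^'+, f (configuration X s w) = f (configuration X t w).
Proof.
move=> t0; have /filter_forall : forall i, \forall s \near t^'+, X i s w = X i t w.
  by move=> i; exact: (chain_right_continuous (HX.1 i)).
apply: filterS => s Hs; congr f; apply/ffunP => i; rewrite !ffunE; exact: Hs.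
Qed.

Lemma value_left_limit w t : 0 < t ->
  exists b, \forall s \near t^'-, f (configuration X s w) = b.
Proof.
move=> t0.
have /choice[b Hb] : forall i, exists b, \forall s \near t^'-, X i s w = b.
  by move=> i; exact: (chain_left_limits (HX.1 i)).
exists (f [ffun i => b i]); move: Hb => /filter_forall.
by apply: filterS => s Hs; congr f; apply/ffunP => i; rewrite !ffunE; exact: Hs.
Qed.

Lemma measurable_mesh_flip N (i : 'I_N) : measurable (mesh_flip f X i).
Proof. by apply: (measurable_flip_event _ HX); rewrite divr_ge0. Qed.

Lemma measurable_mesh_gt N (K : R) :
  measurable [set w | K < \sum_(i < N) \1_(mesh_flip f X i) w].
Proof.
have mS : measurable_fun setT
    (fun w => \sum_(i < N) (\1_(mesh_flip f X i) w : R)).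
  apply: measurable_sum => i; apply: measurable_indic.
  exact: measurable_mesh_flip.
have := mS measurableT _ (measurable_itv `]K, +oo[); rewrite setTI.
by congr measurable; apply/seteqP; split=> w /=; rewrite in_itv /= andbT.
Qed.

(* A probability takes junk values off the sigma-algebra, so the tail event of
   [num_changes] must first be shown measurable; this identity reduces it to the
   configuration at countably many times. *)
Lemma num_changes_gtE (K : R) :
  [set w | (K%:E < `|num_changes f X w|)%E] =
  \bigcup_N [set w | K < \sum_(i < N.+1) \1_(mesh_flip f X i) w].
Proof.
apply/seteqP; split=> w /=; rewrite gee0_abs ?num_changes_ge0//.
  move=> /mesh_changes_attain[||N]; first exact: value_right_continuous.
    exact: value_left_limit.
  by rewrite card_mesh_changes => KN; exists N.
move=> [N _] /=; rewrite -card_mesh_changes -lte_fin => /lt_le_trans; apply.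
by apply: mesh_changes_le_counting; exact: value_right_continuous.
Qed.

Lemma measurable_num_changes_gt (K : R) :
  measurable [set w | (K%:E < `|num_changes f X w|)%E].
Proof.
rewrite num_changes_gtE; apply: bigcup_measurable => N _.
exact: measurable_mesh_gt.
Qed.

(** All [N.+1] mesh intervals have the same length, hence the same flip probability, so the left
    side is the expected number of mesh flips. *)
Lemma disagreement_le_tail (K : R) (N : nat) : 0 <= K ->
  ((N.+1%:R * disagreement f p (1 - expR (- N.+1%:R^-1)))%:E <=
   K%:E + N.+1%:R%:E * P [set w | K%:E < `|num_changes f X w|])%E.
Proof.
(* [E] is the tail event seen by this one mesh; it lies inside the tail event of [num_changes]. *)
move=> K0; pose E := [set w | K < \sum_(i < N.+1) \1_(mesh_flip f X i) w].
have mE : measurable E by exact: measurable_mesh_gt.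
have mC := measurable_num_changes_gt K.
have -> : (N.+1%:R * disagreement f p (1 - expR (- N.+1%:R^-1)))%:E =
    (\sum_(i < N.+1) P (mesh_flip f X i))%E.
  under eq_bigr => i _.
    rewrite (flip_probability _ HX); last first.
      by rewrite divr_ge0//= ler_pM2r ?invr_gt0// ler_nat.
    rewrite -natr1 mulrDl mul1r addrAC subrr add0r; over.
  by rewrite sumEFin sumr_const card_ord mulr_natl.
have HE w : ~ E w -> \sum_(i < N.+1) \1_(mesh_flip f X i) w <= K.
  by move=> /negP; rewrite -leNgt.
apply: le_trans (sum_measure_le P (@measurable_mesh_flip N.+1) mE K0 HE) _.
apply: leeD2l; apply: lee_wpmul2l; first by rewrite lee_fin.
by apply: le_measure; rewrite ?inE// num_changes_gtE => w Ew; exists N.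
Qed.

End dynamics_paths.

(** * Choice of a noise level uniform in [n] *)

Theorem proposition1p13 (R : realType) (m : nat -> nat)
    (f : forall n, {ffun 'I_(m n) -> bool} -> bool)
    (p : nat -> R) (hp : forall n, 0 <= p n <= 1)
    (d : nat -> measure_display) (T : forall n, measurableType (d n))
    (P : forall n, probability (T n) R)
    (X : forall n, 'I_(m n) -> R -> T n -> bool)
    (hX : forall n, bit_dynamics (P n) (p n) (X n)) :
  tame f P X -> noise_stable f p.
Proof.
move=> tameX delta delta0.
(* Half of [delta] pays for the tail probability, the other half for [K / N.+1]. *)
have [K0 HK0] := tameX (delta / 2) (divr_gt0 delta0 (ltr0Sn _ 1)).
(* The bound [K0] may be negative; raising it to 0 only shrinks the tail event. *)
pose K := Num.max K0 0.
have K_ge0 : 0 <= K by rewrite le_max lexx orbT.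
(* Chosen so that [K / N.+1 < delta / 2]; it depends on [delta] and [K] but not on [n]. *)
pose N := Num.truncn (2 * K / delta).
have NK : 2 * K < N.+1%:R * delta.
  by rewrite -ltr_pdivrMr//; exact: truncnS_gt.
exists (1 - expR (- N.+1%:R^-1)); split.
  by rewrite subr_gt0 expR_lt1 oppr_lt0 invr_gt0 ltr0n gerBl expR_ge0.
move=> n; have := disagreement_le_tail (f n) (hX n) N K_ge0.
set D := disagreement _ _ _; set A := [set w | _] => HD.
have HA : (P n A <= (delta / 2)%:E)%E.
  apply: le_trans (HK0 n).
  apply: le_measure; rewrite ?inE.
  - exact: (measurable_num_changes_gt _ (hX n)).
  - exact: (measurable_num_changes_gt _ (hX n)).
  - by move=> w; apply: le_lt_trans; rewrite lee_fin le_max lexx.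
have : ((N.+1%:R * D)%:E <= (K + N.+1%:R * (delta / 2))%:E)%E.
  by rewrite EFinD (EFinM _ (delta / 2)) (le_trans HD)// leeD2l// lee_wpmul2l// lee_fin.
rewrite lee_fin => ND.
by rewrite -(@ler_pM2l _ N.+1%:R)// (le_trans ND)//; lra.
Qed.
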